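(* Let $A\in \mathrm{SL}_2(\mathbb{Z})$ and let $G_A=\mathbb{Z}^2\rtimes_A\mathbb{Z}$ be the corresponding abelian-by-cyclic group. (i) If $|\mathrm{tr}(A)|>2$, then any length function $l:\mathbb{Z}^2\rtimes_A\mathbb{Z}\to\mathbb{R}_{\geq 0}$ vanishes on $\mathbb{Z}^2$. (ii) If $|\mathrm{tr}(A)|=2$ and $A\neq I_2$, then any length function $l:\mathbb{Z}^2\rtimes_A\mathbb{Z}\to\mathbb{R}_{\geq 0}$ vanishes on the direct summand of $\mathbb{Z}^2$ spanned by eigenvectors of $A$.
   Context: A function $l:G\to[0,\infty)$ on a group $G$ is a length function if (1) $l(g^n)=|n|\,l(g)$ for all $g\in G$, $n\in\mathbb{Z}$; (2) $l(hgh^{-1})=l(g)$ for all $g,h\in G$; (3) $l(ab)\le l(a)+l(b)$ for all commuting elements $a,b\in G$. In $\mathbb{Z}^2\rtimes_A\mathbb{Z}$ a generator $t$ of $\mathbb{Z}$ acts on $\mathbb{Z}^2$ by $tvt^{-1}=Av$.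
   Formalization: Part (ii) is proved with the extra hypothesis A ≠ −I₂; for A = −I₂ it is false: l(v,k)=|v₀| for k even and 0 for k odd is a length function that does not vanish on Z², which is spanned by eigenvectors. *)

(* Defs.v *)
From HB Require Import structures.
From mathcomp Require Import all_boot all_order all_algebra.
From mathcomp Require Import reals.

Set Implicit Arguments.
Unset Strict Implicit.
Unset Printing Implicit Defensive.

Import Order.TTheory GRing.Theory Num.Theory.

Local Open Scope ring_scope.

Definition expgz (G : groupType) (g : G) (n : int) : G :=
  match n with
  | Posz m => (g ^+ m)%g
  | Negz m => (g ^- m.+1)%g
  end.

Record length_function (R : realType) (G : groupType) (l : G -> R) : Prop := {
  length_ge0 : forall g : G, 0 <= l g;
  length_expgz : forall (g : G) (n : int), l (expgz g n) = `|n|%:~R * l g;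
  length_conj : forall g h : G, l (h * g * h^-1)%g = l g;
  length_commute : forall a b : G, commute a b -> l (a * b)%g <= l a + l b
}.

Record SL2Z := MkSL2Z {
  SL2Z_mx :> 'M[int]_2;
  det_SL2Z : \det SL2Z_mx = 1
}.

Lemma SL2Z_unit (A : SL2Z) : (A : 'M[int]_2) \is a GRing.unit.
Proof. by rewrite unitmxE det_SL2Z unitr1. Qed.

(* The pair (v, m) stands for v t^m; then t v t^-1 = A v. *)
Definition semidirect (A : SL2Z) : Type := ('cV[int]_2 * int)%type.

HB.instance Definition _ (A : SL2Z) := Choice.on (semidirect A).

Section SemidirectGroup.
Variable A : SL2Z.
Local Notation M := (A : 'M[int]_2).

Definition sd_one : semidirect A := (0, 0).
Definition sd_mul (x y : semidirect A) : semidirect A :=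
  (x.1 + M ^ x.2 *m y.1, x.2 + y.2).
Definition sd_inv (x : semidirect A) : semidirect A :=
  (- (M ^ (- x.2) *m x.1), - x.2).

Fact sd_mulA : associative sd_mul.
Proof.
move=> [u k] [v m] [w n]; rewrite /sd_mul /=; congr pair; last by rewrite addrA.
by rewrite mulmxDr addrA mulmxA (exprzDr (SL2Z_unit A)).
Qed.

Fact sd_mul1 : left_id sd_one sd_mul.
Proof. by move=> [v m]; rewrite /sd_mul /= expr0z mul1mx !add0r. Qed.

Fact sd_mulr1 : right_id sd_one sd_mul.
Proof. by move=> [v m]; rewrite /sd_mul /= mulmx0 !addr0. Qed.

Fact sd_mulV : left_inverse sd_one sd_inv sd_mul.
Proof. by move=> [v m]; rewrite /sd_mul /sd_inv /= !addNr. Qed.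

Fact sd_mulrV : right_inverse sd_one sd_inv sd_mul.
Proof.
move=> [v m]; rewrite /sd_mul /sd_inv /= mulmxN mulmxA.
by rewrite -[M ^ m *m _](exprzDr (SL2Z_unit A)) !subrr expr0z mul1mx subrr.
Qed.

HB.instance Definition _ :=
  isGroup.Build (semidirect A) sd_mulA sd_mul1 sd_mulr1 sd_mulV sd_mulrV.

Definition inZ2 (v : 'cV[int]_2) : semidirect A := (v, 0).
Definition gent : semidirect A := (0, 1).

Lemma gent_conj (v : 'cV[int]_2) : (gent * inZ2 v * gent^-1)%g = inZ2 (M *m v).
Proof.
rewrite [LHS](_ : _ = sd_mul (sd_mul gent (inZ2 v)) (sd_inv gent)) //.
by rewrite /sd_mul /sd_inv /= expr1z mulmx0 oppr0 mulmx0 add0r !addr0.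
Qed.
End SemidirectGroup.

(* An eigenvalue of M with an eigenvector in Z^2 is rational and a root of a
   monic integer polynomial, so it is an integer. *)
Definition eigenvector (M : 'M[int]_2) (v : 'cV[int]_2) : Prop :=
  v <> 0 /\ exists c : int, M *m v = c *: v.

Definition Zspan (S : 'cV[int]_2 -> Prop) (v : 'cV[int]_2) : Prop :=
  exists (n : nat) (c : 'I_n -> int) (w : 'I_n -> 'cV[int]_2),
    (forall i, S (w i)) /\ v = \sum_(i < n) c i *: w i.

Definition is_subgroup (L : 'cV[int]_2 -> Prop) : Prop :=
  L 0 /\ forall u v, L u -> L v -> L (u - v).

Definition direct_summand (L : 'cV[int]_2 -> Prop) : Prop :=
  is_subgroup L /\
  exists K : 'cV[int]_2 -> Prop,
    [/\ is_subgroup K,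
        forall v, exists x y, [/\ L x, K y & v = x + y]
      & forall v, L v -> K v -> v = 0].

(* Main.v *)
Require Import Defs.
From mathcomp Require Import all_boot all_order all_algebra.
From mathcomp Require Import boolp reals.
From mathcomp Require Import ring.

(** Restricted to [Z^2], a length function [l] is a seminorm [f]: elements of
    [Z^2] commute, so [f] is subadditive, and [f (a v) = |a| f v].  Conjugation
    by [t] acts on [Z^2] as [A], so [f] is also [A]-invariant
    ([length_invariant_seminorm]).  What remains is linear algebra over [Z].

    Let [T = \tr A].  By Cayley-Hamilton [T (A v) = A (A v) + v], and applying
    [f] gives [|T| f v <= 2 f v]; hence [f = 0] when [|T| > 2]
    ([snorm_trace]).

    When [|T| = 2], write [T = 2 e] with [e = 1] or [e = -1]; then
    [N = A - e] satisfies [N^2 = 0], and [e] is the only eigenvalue, so the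
    eigenvectors span the kernel of [N] ([Zspan_eigenvector_ker]).  The kernel
    of an integer matrix is always a direct summand, as its Smith normal form
    shows ([ker_direct_summand]).  On the image of [N] the seminorm vanishes:
    up to signs, the powers of [A] move [w] along the line [w + k (N w)], on
    which [f] is thus bounded, while [f (k (N w)) = k f (N w)]
    ([snorm_shear]).  Finally [N <> 0] has rank one, and its image lies in its
    kernel, so every vector of the kernel has a nonzero multiple in the image
    ([trace0_ker_col]), and [f] vanishes on the kernel too. *)

Import Order.TTheory GRing.Theory Num.Theory.
Local Open Scope ring_scope.

(** The part of a length function that the argument uses, on [Z^n]. *)
Record invariant_seminorm (R : realType) (n : nat) (M : 'M[int]_n)
    (f : 'cV[int]_n -> R) : Prop := {
  snorm_ge0 : forall v, 0 <= f v;
  snormZ : forall (a : int) v, f (a *: v) = `|a|%:~R * f v;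
  snormD : forall u v, f (u + v) <= f u + f v;
  snorm_inv : forall v, f (M *m v) = f v
}.
Arguments snorm_ge0 {R n M f}.
Arguments snormZ {R n M f}.
Arguments snormD {R n M f}.
Arguments snorm_inv {R n M f}.

Lemma inZ2D (A : SL2Z) (u v : 'cV[int]_2) :
  (inZ2 A u * inZ2 A v)%g = inZ2 A (u + v).
Proof.
rewrite [LHS](_ : _ = @sd_mul A (inZ2 A u) (inZ2 A v)) //.
by rewrite /sd_mul /= expr0z mul1mx addr0.
Qed.

Lemma inZ2N (A : SL2Z) (v : 'cV[int]_2) : (inZ2 A v)^-1%g = inZ2 A (- v).
Proof.
rewrite [LHS](_ : _ = @sd_inv A (inZ2 A v)) //.
by rewrite /sd_inv /= oppr0 expr0z mul1mx.
Qed.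

Lemma inZ2Z (A : SL2Z) (a : int) (v : 'cV[int]_2) :
  expgz (inZ2 A v) a = inZ2 A (a *: v).
Proof.
have expn m : (inZ2 A v ^+ m)%g = inZ2 A (v *+ m).
  by elim: m => // m IH; rewrite expgS IH inZ2D mulrS.
case: a => m; rewrite /expgz expn.
  by rewrite -[in RHS]natz scaler_nat.
by rewrite inZ2N NegzE scaleNr -natz scaler_nat.
Qed.

Lemma length_invariant_seminorm (R : realType) (A : SL2Z)
    (l : semidirect A -> R) :
  length_function l -> invariant_seminorm R 2 A (fun v => l (inZ2 A v)).
Proof.
move=> [l_ge0 lX lJ lM]; split=> [v|a v|u v|v]; first exact: l_ge0.
- by rewrite -inZ2Z lX.
- by rewrite -inZ2D; apply: lM; rewrite /commute !inZ2D addrC.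
- by rewrite -gent_conj lJ.
Qed.

Lemma snorm0 {R : realType} {n} {M : 'M[int]_n} {f} :
  invariant_seminorm R n M f -> f 0 = 0.
Proof. by move=> fP; rewrite -(scale0r 0) (snormZ fP) normr0 mul0r. Qed.

Lemma snormZ_eq0 {R : realType} {n} {M : 'M[int]_n} {f} (a : int) v :
  invariant_seminorm R n M f -> a != 0 -> f (a *: v) = 0 -> f v = 0.
Proof.
move=> fP a_neq0 /eqP; rewrite (snormZ fP) mulf_eq0 intr_eq0 normr_eq0.
by rewrite (negPf a_neq0) => /eqP.
Qed.

Lemma Zspan_snorm0 {R : realType} {M : 'M[int]_2} {f} S v :
  invariant_seminorm R 2 M f -> (forall w, S w -> f w = 0) ->
  Zspan S v -> f v = 0.
Proof.
move=> fP fS [n [c [w [Sw ->]]]].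
elim/big_ind: _ => [|x y fx fy|i _]; first exact: (snorm0 fP).
  apply/le_anti; rewrite (snorm_ge0 fP) andbT.
  by apply: le_trans (snormD fP _ _) _; rewrite fx fy addr0.
by rewrite (snormZ fP) fS ?mulr0.
Qed.

(** The Archimedean property, in the form that turns a bounded orbit into a
    vanishing seminorm. *)
Lemma archi_eq0 {R : realType} (a b : R) :
  0 <= a -> (forall n : nat, n%:R * a <= b) -> a = 0.
Proof.
move=> a_ge0 le_ab; apply/eqP/negP => /negP a_neq0.
have a_gt0 : 0 < a by rewrite lt_def a_neq0.
have b_ge0 : 0 <= b by rewrite -(mul0r a) (le_ab 0).
have := archi_boundP (divr_ge0 b_ge0 a_ge0).
by rewrite ltr_pdivrMr // ltNge le_ab.
Qed.

(** Up to the sign [e], the matrix [M] translates [w] by [e *: u] and fixes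
    [u], so [f] is constant along the points [w + k *: (e *: u)]; by the
    triangle inequality [k * f u <= 2 * f w] for every [k]. *)
Lemma snorm_shear {R : realType} {n} {M : 'M[int]_n} {f} (e : int) u w :
  invariant_seminorm R n M f -> e * e = 1 ->
  M *m u = e *: u -> M *m w = e *: w + u -> f u = 0.
Proof.
move=> fP ee Mu Mw.
have norm_e : `|e| = 1 :> int.
  by apply/eqP; rewrite -sqrp_eq1 // -normrX expr2 ee.
have fe v : f (e *: v) = f v by rewrite (snormZ fP) norm_e mul1r.
have orbit (k : nat) : f (w + k%:Z *: (e *: u)) = f w.
  elim: k => [|k <-]; first by rewrite scale0r addr0.
  rewrite -[RHS](snorm_inv fP) -[LHS]fe; congr (f _).
  rewrite mulmxDr -!scalemxAr Mw Mu scalerDr !scalerA -addrA; congr (_ + _).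
  rewrite -[X in _ = X + _]scale1r -scalerDl; congr (_ *: _).
  by rewrite mulrAC -[k%:Z * e * e]mulrA ee mul1r mulr1 -add1n.
rewrite -fe; apply: (archi_eq0 _ (f w + f w)) => [|k].
  exact: (snorm_ge0 fP).
have -> : k%:R * f (e *: u) = f (k%:Z *: (e *: u)).
  by rewrite [RHS](snormZ fP) ger0_norm.
have {1}-> : k%:Z *: (e *: u) = (w + k%:Z *: (e *: u)) + (-1) *: w.
  by rewrite scaleN1r addrAC subrr add0r.
apply: le_trans (snormD fP _ _) _.
by rewrite orbit (snormZ fP) normrN1 mul1r.
Qed.

Lemma sum_ord2 (V : nmodType) (F : 'I_2 -> V) : \sum_i F i = F 0 + F 1.
Proof. by rewrite big_ord_recl big_ord1; congr (_ + F _); apply: val_inj. Qed.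

Lemma ord2P (k : 'I_2) : k = 0 \/ k = 1.
Proof. by case: k => [[|[|]]] // p; [left | right]; apply: val_inj. Qed.

Lemma det_mx2 (K : comNzRingType) (M : 'M[K]_2) :
  \det M = M 0 0 * M 1 1 - M 0 1 * M 1 0.
Proof.
rewrite (expand_det_row _ 0) sum_ord2 /cofactor !det_mx11 !mxE /=.
have -> : lift 0 0 = 1 :> 'I_2 by apply: val_inj.
have -> : lift 1 0 = 0 :> 'I_2 by apply: val_inj.
by rewrite expr0 mul1r expr1 mulN1r mulrN.
Qed.

Lemma Cayley_Hamilton2 (K : comNzRingType) (M : 'M[K]_2) :
  M *m M = \tr M *: M - (\det M)%:M.
Proof.
apply/matrixP=> i j; rewrite det_mx2 /mxtrace sum_ord2 !mxE sum_ord2.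
by case: (ord2P i) => ->; case: (ord2P j) => ->; rewrite ?mulr1n ?mulr0n; ring.
Qed.

(** For two by two matrices [det (N w, v) + det (w, N v) = \tr N * det (w, v)].
    When [N] is traceless and kills [v], this makes every [N w] parallel to
    [v]; the equation is that proportionality for the basis vector [w] of
    index [j]. *)
Lemma trace0_ker_col (K : comNzRingType) (N : 'M[K]_2) (v : 'cV[K]_2) i j :
  \tr N = 0 -> N *m v = 0 -> N i j *: v = v i 0 *: col j N.
Proof.
rewrite /mxtrace sum_ord2 => trN /matrixP Nv.
have := Nv 0 0; have := Nv 1 0; rewrite !mxE !sum_ord2 => N1 N0.
have N11 : N 1 1 = - N 0 0 by apply/eqP; rewrite -addr_eq0 addrC trN.
have {}N0 : N 0 1 * v 1 0 = - (N 0 0 * v 0 0).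
  by apply/eqP; rewrite -addr_eq0 addrC N0.
have {}N1 : N 1 0 * v 0 0 = N 0 0 * v 1 0.
  by apply/eqP; rewrite -subr_eq0 -mulNr -N11 N1.
apply/matrixP=> k z; rewrite ord1 !mxE.
by case: (ord2P i) => ->; case: (ord2P j) => ->; case: (ord2P k) => ->;
  rewrite ?N11; ring: N0 N1.
Qed.

(** Cayley-Hamilton reads [\tr M *: (M *m v) = M *m (M *m v) + v], and the
    three vectors [v], [M *m v], [M *m (M *m v)] have the same seminorm. *)
Lemma snorm_trace {R : realType} {M : 'M[int]_2} {f} v :
  invariant_seminorm R 2 M f -> \det M = 1 -> 2 < `|\tr M| -> f v = 0.
Proof.
move=> fP detM trM.
have CH : \tr M *: (M *m v) = M *m (M *m v) + v.
  by rewrite mulmxA Cayley_Hamilton2 detM mulmxBl mul1mx -scalemxAl subrK.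
have := snormD fP (M *m (M *m v)) v.
rewrite -CH (snormZ fP) !(snorm_inv fP) => le_f.
apply/eqP/negP => /negP f_neq0.
have f_gt0 : 0 < f v by rewrite lt_def f_neq0 (snorm_ge0 fP).
move: le_f; rewrite -mulr2n -mulr_natl ler_pM2r //.
by rewrite (_ : 2%:R = (2 : int)%:~R) // ler_int leNgt trM.
Qed.

(** In Smith normal form [N = L D P], with [L] and [P] invertible, the kernel
    consists of the [v] such that [P *m v] is zero at each index carrying a
    nonzero diagonal entry of [D].  The vectors [v] such that [P *m v] is zero
    at all the other indices form a complement. *)
Lemma ker_direct_summand m (N : 'M[int]_(m, 2)) :
  direct_summand (fun v => N *m v = 0).
Proof.
have [L uL [P uP [d _ ->]]] := int_Smith_normal_form N.
set D := \matrix_(i, j) _.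
have kerE (v : 'cV[int]_2) : L *m D *m P *m v = 0 <-> D *m (P *m v) = 0.
  rewrite -!mulmxA; split=> [Lv|->]; last by rewrite mulmx0.
  by rewrite -[LHS](mulKmx uL) Lv mulmx0.
(* An index beyond the number of rows of [D] imposes no condition, whatever
   the list [d] contains there. *)
pose live (j : 'I_2) := (j < m)%N && (d`_j != 0).
have DE (v : 'cV[int]_2) : D *m v = 0 <-> forall j, live j -> v j 0 = 0.
  have Dv i : (D *m v) i 0 = \sum_(j < 2) d`_i *+ (i == j :> nat) * v j 0.
    by rewrite !mxE; apply: eq_bigr => j _; rewrite !mxE.
  split=> [Dv0 j /andP[lt_jm dj]|v0].
    have := Dv (Ordinal lt_jm); rewrite Dv0 mxE (bigD1 j) //= eqxx mulr1n.
    rewrite big1 ?addr0 => [/esym/eqP|k /negPf]; last first.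
      by rewrite -val_eqE eq_sym /= => ->; rewrite mul0r.
    by rewrite mulf_eq0 (negPf dj) => /eqP.
  apply/matrixP=> i z; rewrite ord1 Dv mxE big1 // => j _.
  case: eqP => [ij|_]; last by rewrite mul0r.
  have [->|di] := eqVneq d`_i 0; first by rewrite mul0rn mul0r.
  by rewrite v0 ?mulr0 // /live -ij ltn_ord.
pose part (b : bool) (v : 'cV[int]_2) :=
  \col_j if live j == b then (P *m v) j 0 else 0.
split; first split; first by rewrite mulmx0.
  by move=> u v Nu Nv; rewrite mulmxBr Nu Nv subrr.
exists (fun v => forall j, ~~ live j -> (P *m v) j 0 = 0); split.
- split=> [j _|u v u0 v0 j nj]; first by rewrite mulmx0 mxE.
  by rewrite mulmxBr mxE u0 // mxE v0 // subrr.
- move=> v; exists (invmx P *m part false v), (invmx P *m part true v).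
  split=> [|j nj|].
  + by apply/kerE/DE => j lj; rewrite mulKVmx // mxE lj.
  + by rewrite mulKVmx // mxE (negPf nj).
  + rewrite -mulmxDr -[LHS](mulKmx uP); congr (_ *m _).
    apply/matrixP=> j z; rewrite ord1 !mxE.
    by case: (live j); rewrite /= ?addr0 ?add0r.
- move=> v /kerE/DE v0 v1; rewrite -[v](mulKmx uP).
  rewrite (_ : P *m v = 0) ?mulmx0 //.
  apply/matrixP=> j z; rewrite ord1 [RHS]mxE.
  by have [/v0|/v1] := boolP (live j).
Qed.

(** The characteristic polynomial is [('X - e) ^+ 2], so [(c - e) ^+ 2] kills
    the eigenvector. *)
Lemma eigenvalue_tr2 (M : 'M[int]_2) (e c : int) (v : 'cV[int]_2) :
  \det M = 1 -> \tr M = 2 * e -> e * e = 1 ->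
  v <> 0 -> M *m v = c *: v -> c = e.
Proof.
move=> detM trM ee v_neq0 Mv.
have : ((c - e) ^+ 2) *: v = 0.
  have : M *m M *m v = c *: (c *: v) by rewrite -mulmxA Mv -scalemxAr Mv.
  rewrite Cayley_Hamilton2 detM trM mulmxBl mul1mx -scalemxAl Mv !scalerA.
  move=> /eqP; rewrite -[X in _ - X]scale1r -scalerBl -subr_eq0 -scalerBl.
  move=> /eqP v0; rewrite -[RHS]oppr0 -[in RHS]v0 -scaleNr; congr (_ *: _).
  have -> : (c - e) ^+ 2 = c * c - 2 * e * c + e * e by ring.
  by rewrite ee; ring.
move=> /eqP; rewrite scalemx_eq0 expf_eq0 /= subr_eq0.
by case/orP=> /eqP.
Qed.

Lemma Zspan_eigenvector_ker (M : 'M[int]_2) (e : int) :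
  \det M = 1 -> \tr M = 2 * e -> e * e = 1 ->
  Zspan (eigenvector M) = (fun v => (M - e%:M) *m v = 0).
Proof.
move=> detM trM ee; apply/funext=> v; apply/propext.
have kerE (w : 'cV[int]_2) : (M - e%:M) *m w = 0 <-> M *m w = e *: w.
  by rewrite mulmxBl mul_scalar_mx; split=> [/subr0_eq|->]; rewrite ?subrr.
split=> [[n [c [w [eig_w ->]]]]|/kerE Mv].
  rewrite mulmx_sumr big1 // => i _; rewrite -scalemxAr.
  have [w_neq0 [a Mw]] := eig_w i.
  by rewrite (iffRL (kerE _)) ?scaler0 // -(eigenvalue_tr2 M e a (w i)).
have [->|/eqP v_neq0] := eqVneq v 0.
  exists 0%N, (fun=> 0), (fun=> 0); split; first by case.
  by rewrite big_ord0.
exists 1%N, (fun=> 1), (fun=> v); split; last by rewrite big_ord1 scale1r.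
by move=> _; split=> //; exists e.
Qed.

(** Since [N = M - e] has square zero, [M] sends a basis vector to [e] times
    itself plus a column of [N] and multiplies that column by [e]: the
    situation of [snorm_shear].  So [f] vanishes on the columns of [N], and by
    [trace0_ker_col] a nonzero multiple of [v] is proportional to one of
    them. *)
Lemma snorm_eigenvector_tr2 {R : realType} {M : 'M[int]_2} {f} (e : int) v :
  invariant_seminorm R 2 M f ->
  \det M = 1 -> \tr M = 2 * e -> e * e = 1 -> M <> e%:M ->
  (M - e%:M) *m v = 0 -> f v = 0.
Proof.
move=> fP detM trM ee M_neq Nv.
set N := M - e%:M in Nv *.
have trN : \tr N = 0 by rewrite raddfB /= trM mxtrace_scalar mulr2n; ring.
have ME : M = N + e%:M by rewrite subrK.
have NN : N *m N = 0.
  rewrite Cayley_Hamilton2 trN scale0r sub0r det_mx2 !mxE /=.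
  move: detM trM; rewrite det_mx2 /mxtrace sum_ord2 => detM trM.
  rewrite (_ : _ - _ = 0) ?raddf0 ?oppr0 //.
  have M11 : M 1 1 = 2 * e - M 0 0 by rewrite -trM; ring.
  rewrite M11 !addr0 !mulr1n.
  transitivity (M 0 0 * M 1 1 - M 0 1 * M 1 0 - e * e).
    by rewrite M11; ring.
  by rewrite detM ee subrr.
have [i [j Nij]] : exists i j, N i j != 0.
  apply: contrapT => N0; apply: M_neq; rewrite ME.
  rewrite (_ : N = 0) ?add0r //; apply/matrixP=> i j; rewrite [RHS]mxE.
  by apply/eqP/negPn/negP => Nij; apply: N0; exists i, j.
apply: (snormZ_eq0 (N i j) v fP Nij); rewrite (trace0_ker_col _ _ _ _ _ trN Nv).
rewrite (snormZ fP).
rewrite (snorm_shear e (col j N) (delta_mx j 0) fP ee) ?mulr0 // colE ME.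
  by rewrite mulmxDl mulmxA NN mul0mx add0r mul_scalar_mx.
by rewrite mulmxDl mul_scalar_mx addrC.
Qed.

Theorem theorem0p1 (R : realType) (A : SL2Z) :
  (2 < `|\tr A| ->
     forall l : semidirect A -> R, length_function l ->
     forall v : 'cV[int]_2, l (inZ2 A v) = 0) /\
  (`|\tr A| = 2 -> (A : 'M[int]_2) <> 1%:M -> (A : 'M[int]_2) <> - 1%:M ->
     direct_summand (Zspan (eigenvector A)) /\
     forall l : semidirect A -> R, length_function l ->
     forall v : 'cV[int]_2, Zspan (eigenvector A) v -> l (inZ2 A v) = 0).
Proof.
have detA := det_SL2Z A.
split=> [trA l /length_invariant_seminorm lP v|trA A_neq1 A_neqN1].
  exact: (snorm_trace v lP).
have [e [ee trE A_neq]] :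
    exists e : int, [/\ e * e = 1, \tr A = 2 * e & (A : 'M[int]_2) <> e%:M].
  have [tr_ge0|tr_lt0] := ger0P (\tr A); [exists 1 | exists (- 1)].
    by split=> //; rewrite -trA ger0_norm // mulr1.
  split=> //; first by rewrite mulrN1 -trA ltr0_norm // opprK.
  by rewrite raddfN.
rewrite (Zspan_eigenvector_ker A e) //; split=> [|l lP v Nv].
  exact: ker_direct_summand.
exact: (snorm_eigenvector_tr2 e v (length_invariant_seminorm _ _ _ lP)).
Qed.
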